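(* Let $\Lambda$ be a Noetherian semiperfect ring. The following are equivalent for any $M \in \underline{\mathsf{mod}}\, \Lambda$ and $n \geq 0$: (i) $\Omega^n M$ is a stable retract of $\Omega^{n+1} N$ for some $N \in \underline{\mathsf{mod}}\, \Lambda$. (ii) $\Omega^n M$ is a stable retract of $\Omega^{n+1}\Sigma^{n+1}\Omega^n M$. (iii) The unit map $\eta_{n+1} : \Omega^n M \to \Omega^{n+1}\Sigma^{n+1}\Omega^n M$ splits in $\underline{\mathsf{mod}}\, \Lambda$. Therefore the delooping level of $M$ is equal to $$\operatorname{dell} M = \inf\{ n \geq 0 \mid \eta_{n+1} : \Omega^n M \to \Omega^{n+1}\Sigma^{n+1}\Omega^n M \text{ splits in } \underline{\mathsf{mod}}\, \Lambda\}.$$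
   Context: Noetherian means two-sided Noetherian. $\mathsf{mod}\,\Lambda$ is the category of finitely presented right $\Lambda$-modules. The stable category $\underline{\mathsf{mod}}\, \Lambda$ has the same objects, with morphisms taken modulo those factoring through projective objects; a stable retract is a retract in $\underline{\mathsf{mod}}\,\Lambda$. The syzygy functor $\Omega$ on $\underline{\mathsf{mod}}\,\Lambda$ is $\Omega M = \ker(P \twoheadrightarrow M)$ for any epimorphism from a projective $P$ in $\mathsf{mod}\,\Lambda$. The Auslander–Bridger transpose $\mathrm{Tr} : \underline{\mathsf{mod}}\,\Lambda \to \underline{\mathsf{mod}}\,\Lambda^{op}$ sends $M$ with presentation $P_1 \to P_0 \to M \to 0$ by finitely generated projectives to $\mathrm{coker}(P_0^* \to P_1^* )$, $(-)^* = \mathrm{Hom}(-,\Lambda)$; it is a contravariant duality. Put $\Sigma := \mathrm{Tr}\,\Omega\,\mathrm{Tr}$; by a result of Auslander–Reiten $\Sigma$ is left adjoint to $\Omega$ on $\underline{\mathsf{mod}}\,\Lambda$, so $\Sigma^n$ is left adjoint to $\Omega^n$, and $\eta_n : X \to \Omega^n\Sigma^n X$ denotes the unit. ''$\eta_n$ splits'' means that $\eta_n$ is a section (split monomorphism) in $\underline{\mathsf{mod}}\,\Lambda$. The delooping level is defined by $\operatorname{dell} M := \inf\{ n \geq 0 \mid \Omega^n M \text{ is a stable retract of } \Omega^{n+1} N \text{ for some } N \in \underline{\mathsf{mod}}\, \Lambda\}$ ($\infty$ if no such $n$ exists). *)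

(* Defs.v *)
From HB Require Import structures.
From mathcomp Require Import all_boot all_order ssralg zmodp matrix generic_quotient.
From mathcomp Require Import boolp.

Set Implicit Arguments.
Unset Strict Implicit.
Unset Printing Implicit Defensive.

Import GRing.Theory.
Local Open Scope ring_scope.

(* A category is presented with its equality of morphisms as an explicit
   relation, so that the stable category can keep linear maps as morphisms and
   use equality modulo maps factoring through projectives. *)
Record category := Cat {
  ob :> Type;
  hom : ob -> ob -> Type;
  heq : forall X Y, hom X Y -> hom X Y -> Prop;
  idm : forall X, hom X X;
  compm : forall X Y Z, hom Y Z -> hom X Y -> hom X Z;
  heq_refl : forall X Y (f : hom X Y), heq f f;
  heq_sym : forall X Y (f g : hom X Y), heq f g -> heq g f;
  heq_trans : forall X Y (f g h : hom X Y), heq f g -> heq g h -> heq f h;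
  comp_heq : forall X Y Z (g g' : hom Y Z) (f f' : hom X Y),
    heq g g' -> heq f f' -> heq (compm g f) (compm g' f');
  compmA : forall X Y Z T (h : hom Z T) (g : hom Y Z) (f : hom X Y),
    heq (compm h (compm g f)) (compm (compm h g) f);
  comp1m : forall X Y (f : hom X Y), heq (compm (idm Y) f) f;
  compm1 : forall X Y (f : hom X Y), heq (compm f (idm X)) f }.

Arguments hom {c} _ _.
Arguments heq {c X Y} _ _.
Arguments idm {c} X.
Arguments compm {c X Y Z} _ _.
Arguments heq_sym {c X Y f g} _.
Arguments heq_trans {c X Y f g h} _ _.
Arguments comp_heq {c X Y Z g g' f f'} _ _.

Notation "f =~ g" := (heq f g) (at level 70, no associativity).
Notation "g \oo f" := (compm g f) (at level 50, left associativity).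

Definition retract (C : category) (X Y : C) : Prop :=
  exists (s : hom X Y) (r : hom Y X), r \oo s =~ idm X.

Definition split_mono (C : category) (X Y : C) (s : hom X Y) : Prop :=
  exists r : hom Y X, r \oo s =~ idm X.

Definition opcat (C : category) : category :=
  @Cat C (fun X Y => hom Y X) (fun X Y => @heq C Y X) (fun X => idm X)
    (fun X Y Z g f => f \oo g)
    (fun X Y => @heq_refl C Y X) (fun X Y f g => @heq_sym C Y X f g)
    (fun X Y f g h => @heq_trans C Y X f g h)
    (fun X Y Z g g' f f' eg ef => comp_heq ef eg)
    (fun X Y Z T h g f => heq_sym (compmA f g h))
    (fun X Y => @compm1 C Y X) (fun X Y => @comp1m C Y X).

Record functor (C D : category) := Functor {
  fob :> C -> D;
  fmap : forall X Y, hom X Y -> hom (fob X) (fob Y);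
  fmap_heq : forall X Y (f g : hom X Y), f =~ g -> fmap f =~ fmap g;
  fmap1 : forall X, fmap (idm X) =~ idm (fob X);
  fmapM : forall X Y Z (g : hom Y Z) (f : hom X Y),
    fmap (g \oo f) =~ fmap g \oo fmap f }.

Arguments fmap {C D} f0 {X Y} _.
Arguments fmap_heq {C D} f0 {X Y f g} _.
Arguments fmapM {C D} f0 {X Y Z} g f.

Definition fid (C : category) : functor C C :=
  @Functor C C id (fun X Y f => f) (fun X Y f g e => e)
    (fun X => heq_refl (idm X)) (fun X Y Z g f => heq_refl (g \oo f)).

Definition fcomp (C D E : category) (G : functor D E) (F : functor C D) :
    functor C E :=
  @Functor C E (fun X => G (F X)) (fun X Y f => fmap G (fmap F f))
    (fun X Y f g e => fmap_heq G (fmap_heq F e))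
    (fun X => heq_trans (fmap_heq G (fmap1 F X)) (fmap1 G (F X)))
    (fun X Y Z g f => heq_trans (fmap_heq G (fmapM F g f))
                                (fmapM G (fmap F g) (fmap F f))).

Definition fop (C D : category) (F : functor C D) : functor (opcat C) (opcat D) :=
  @Functor (opcat C) (opcat D) F (fun X Y => @fmap C D F Y X)
    (fun X Y f g => @fmap_heq C D F Y X f g)
    (fun X => fmap1 F X) (fun X Y Z g f => fmapM F f g).

Definition fflip (C D : category) (F : functor C (opcat D)) :
    functor (opcat C) D :=
  @Functor (opcat C) D F (fun X Y => @fmap _ _ F Y X)
    (fun X Y f g => @fmap_heq _ _ F Y X f g)
    (fun X => fmap1 F X) (fun X Y Z g f => fmapM F f g).

Fixpoint fpow (C : category) (F : functor C C) (n : nat) : functor C C :=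
  if n is m.+1 then fcomp F (fpow F m) else fid C.

(* Same iterate, associated the other way; with it (fpowr F n, fpow G n) is an
   adjoint pair on the nose. *)
Fixpoint fpowr (C : category) (F : functor C C) (n : nat) : functor C C :=
  if n is m.+1 then fcomp (fpowr F m) F else fid C.

Record adjunction (C D : category) (F : functor C D) (G : functor D C) := Adjunction {
  adj_unit : forall X : C, hom X (G (F X));
  adj_unit_nat : forall X Y (f : hom X Y),
    fmap G (fmap F f) \oo adj_unit X =~ adj_unit Y \oo f;
  adj_unit_ex : forall (X : C) (Y : D) (f : hom X (G Y)),
    exists g : hom (F X) Y, fmap G g \oo adj_unit X =~ f;
  adj_unit_uniq : forall (X : C) (Y : D) (g g' : hom (F X) Y),
    fmap G g \oo adj_unit X =~ fmap G g' \oo adj_unit X -> g =~ g' }.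

Definition adj_id (C : category) : adjunction (fid C) (fid C).
Proof.
exists (fun X => idm X) => [X Y f|X Y f|X Y g g' e] /=.
- exact: heq_trans (compm1 _) (heq_sym (comp1m _)).
- by exists f; apply: compm1.
- exact: heq_trans (heq_trans (heq_sym (compm1 _)) e) (compm1 _).
Defined.

Section AdjComp.
Variables (C D E : category) (F : functor C D) (G : functor D C).
Variables (F' : functor D E) (G' : functor E D).
Variables (a : adjunction F G) (a' : adjunction F' G').

Let u (X : C) : hom X (G (G' (F' (F X)))) := fmap G (adj_unit a' (F X)) \oo adj_unit a X.

Let transpE (X : C) (Y : E) (g : hom (F' (F X)) Y) :
  fmap G (fmap G' g) \oo u X =~ fmap G (fmap G' g \oo adj_unit a' (F X)) \oo adj_unit a X.
Proof.
apply: (heq_trans (compmA _ _ _)); apply: comp_heq; last exact: heq_refl.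
exact: heq_sym (fmapM _ _ _).
Qed.

Let u_nat X Y (f : hom X Y) :
  fmap G (fmap G' (fmap F' (fmap F f))) \oo u X =~ u Y \oo f.
Proof.
apply: heq_trans (transpE _) _.
apply: heq_trans (comp_heq (fmap_heq G (adj_unit_nat a' _)) (heq_refl _)) _.
apply: heq_trans (comp_heq (fmapM G _ _) (heq_refl _)) _.
apply: heq_trans (heq_sym (compmA _ _ _)) _.
apply: heq_trans (comp_heq (heq_refl _) (adj_unit_nat a _)) _.
exact: compmA.
Qed.

Let u_ex (X : C) (Y : E) (f : hom X (G (G' Y))) :
  exists g : hom (F' (F X)) Y, fmap G (fmap G' g) \oo u X =~ f.
Proof.
have [h hE] := adj_unit_ex a f; have [g gE] := adj_unit_ex a' h; exists g.
apply: heq_trans (transpE _) _; apply: heq_trans hE.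
by apply: comp_heq; [apply: fmap_heq|apply: heq_refl].
Qed.

Let u_uniq (X : C) (Y : E) (g g' : hom (F' (F X)) Y) :
  fmap G (fmap G' g) \oo u X =~ fmap G (fmap G' g') \oo u X -> g =~ g'.
Proof.
move=> e; apply: (adj_unit_uniq (a := a')); apply: (adj_unit_uniq (a := a)).
exact: heq_trans (heq_sym (transpE _)) (heq_trans e (transpE _)).
Qed.

Definition adj_comp : adjunction (fcomp F' F) (fcomp G G') :=
  @Adjunction C E (fcomp F' F) (fcomp G G') u u_nat u_ex u_uniq.
End AdjComp.

Fixpoint adj_pow (C : category) (F G : functor C C) (a : adjunction F G) (n : nat) :
    adjunction (fpowr F n) (fpow G n) :=
  if n is m.+1 then adj_comp a (adj_pow a m) else adj_id C.

Section Modules.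
Variable A : pzRingType.
Implicit Types M N P : lmodType A.

Definition mklin M N (f : M -> N) (lf : linear f) : {linear M -> N} :=
  HB.pack f (GRing.isLinear.Build A M N *:%R f lf).

Lemma mklinE M N (f : M -> N) (lf : linear f) x : mklin lf x = f x.
Proof. by []. Qed.

Definition submodule M (U : M -> Prop) : Prop :=
  U 0 /\ forall (a : A) (x y : M), U x -> U y -> U (a *: x + y).

Definition fg_sub M (U : M -> Prop) : Prop :=
  exists (n : nat) (g : 'I_n -> M),
    forall x, U x <-> exists c : 'I_n -> A, x = \sum_i c i *: g i.

Definition finitely_generated M : Prop := fg_sub (fun _ : M => True).

Definition surjective_lin M N (f : {linear M -> N}) : Prop :=
  forall y, exists x, f x = y.

Definition projective P : Prop :=
  forall (M N : lmodType A) (g : {linear M -> N}) (f : {linear P -> N}),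
    surjective_lin g -> exists h : {linear P -> M}, forall x, g (h x) = f x.

Definition fgproj P : Prop := finitely_generated P /\ projective P.

Definition superfluous M (K : M -> Prop) : Prop :=
  forall U : M -> Prop, submodule U ->
    (forall x, exists u k, [/\ U u, K k & x = u + k]) -> forall x, U x.

Definition projective_cover P M (p : {linear P -> M}) : Prop :=
  [/\ projective P, surjective_lin p & superfluous (fun x => p x = 0)].

End Modules.

Definition left_noetherian (A : pzRingType) : Prop :=
  forall I : A^o -> Prop, submodule I -> fg_sub I.

(* Right modules over L are the left modules over the converse ring L^c. *)
Definition noetherian (L : pzRingType) : Prop :=
  left_noetherian L /\ left_noetherian L^c.

Definition semiperfect (L : pzRingType) : Prop :=
  forall M : lmodType L^c, finitely_generated M ->
    exists (P : lmodType L^c) (p : {linear P -> M}), projective_cover p.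

Section Kernel.
Variables (A : pzRingType) (M N : lmodType A) (f : {linear M -> N}).

Definition ker_pred : {pred M} := [pred x | f x == 0].

Lemma ker_submod : submod_closed ker_pred.
Proof.
split=> [|a x y]; first by rewrite inE linear0.
by rewrite !inE linearP => /eqP-> /eqP->; rewrite scaler0 addr0.
Qed.

HB.instance Definition _ := GRing.isSubmodClosed.Build A M ker_pred ker_submod.

Record ker : Type := Ker { ker_val : M; ker_valP : ker_val \in ker_pred }.

HB.instance Definition _ := [isSub for ker_val].
HB.instance Definition _ := [Choice of ker by <:].
HB.instance Definition _ := [SubChoice_isSubLmodule of ker by <:].

Lemma ker_val_linear : linear ker_val. Proof. by move=> a x y. Qed.

Definition ker_inc : {linear ker -> M} := mklin ker_val_linear.

Lemma ker_incP (x : ker) : f (ker_inc x) = 0.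
Proof. by case: x => x /= /eqP. Qed.

Lemma ker_inc_inj : injective ker_inc.
Proof. exact: val_inj. Qed.

Lemma ker_inc_ex (x : M) : f x = 0 -> exists y : ker, ker_inc y = x.
Proof. by move=> /eqP fx; exists (@Ker x fx). Qed.

Section Corestr.
Variables (X : lmodType A) (g : {linear X -> M}) (fg : forall x, f (g x) = 0).

Lemma ker_lift_subproof x : g x \in ker_pred. Proof. by rewrite inE fg. Qed.
Definition ker_lift_fun x : ker := Ker (ker_lift_subproof x).
Lemma ker_lift_linear : linear ker_lift_fun.
Proof. by move=> a x y; apply: val_inj; rewrite /= linearP. Qed.
Definition ker_lift : {linear X -> ker} := mklin ker_lift_linear.
Lemma ker_liftE x : ker_inc (ker_lift x) = g x. Proof. by []. Qed.
End Corestr.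
End Kernel.

Section Cokernel.
Local Open Scope quotient_scope.
Variables (A : pzRingType) (M N : lmodType A) (f : {linear M -> N}).

Definition coker_rel (x y : N) : bool := `[< exists z, f z = x - y >].

Lemma coker_rel_equiv : equiv_class_of coker_rel.
Proof.
split=> [x|x y|y x z].
- by apply/asboolP; exists 0; rewrite linear0 subrr.
- by apply/asboolP/asboolP => -[z fz]; exists (- z); rewrite linearN fz opprB.
- move=> /asboolP[u fu] /asboolP[v fv]; apply/asboolP; exists (u + v).
  by rewrite linearD fu fv addrA subrK.
Qed.

Canonical coker_equiv := EquivRelPack coker_rel_equiv.

Definition coker : Type := {eq_quot coker_equiv}.
HB.instance Definition _ := Choice.on coker.

Definition coker_pi_fun (x : N) : coker := \pi_({eq_quot coker_equiv}) x.
Definition coker_repr (u : coker) : N := repr (u : {eq_quot coker_equiv}).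

Lemma coker_reprK u : coker_pi_fun (coker_repr u) = u. Proof. exact: reprK. Qed.

Lemma coker_piP x y : coker_pi_fun x = coker_pi_fun y <-> exists z, f z = x - y.
Proof. by split=> [/eqmodP/asboolP|h]; last apply/eqmodP/asboolP. Qed.

Lemma coker_repr_pi x : exists z, f z = coker_repr (coker_pi_fun x) - x.
Proof. by apply/coker_piP; rewrite coker_reprK. Qed.

Definition coker_add u v := coker_pi_fun (coker_repr u + coker_repr v).
Definition coker_opp u := coker_pi_fun (- coker_repr u).
Definition coker_scale (a : A) u := coker_pi_fun (a *: coker_repr u).

Lemma coker_piD x y :
  coker_pi_fun (x + y) = coker_add (coker_pi_fun x) (coker_pi_fun y).
Proof.
apply/esym/coker_piP; have [u fu] := coker_repr_pi x.
have [v fv] := coker_repr_pi y; exists (u + v).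
by rewrite linearD fu fv opprD addrACA.
Qed.

Lemma coker_piN x : coker_pi_fun (- x) = coker_opp (coker_pi_fun x).
Proof.
apply/esym/coker_piP; have [u fu] := coker_repr_pi x; exists (- u).
by rewrite linearN fu opprD.
Qed.

Lemma coker_piZ a x : coker_pi_fun (a *: x) = coker_scale a (coker_pi_fun x).
Proof.
apply/esym/coker_piP; have [u fu] := coker_repr_pi x; exists (a *: u).
by rewrite linearZ /= fu scalerBr.
Qed.

Lemma coker_addA : associative coker_add.
Proof.
move=> u v w; rewrite -(coker_reprK u) -(coker_reprK v) -(coker_reprK w).
by rewrite -!coker_piD addrA.
Qed.

Lemma coker_addC : commutative coker_add.
Proof.
by move=> u v; rewrite -(coker_reprK u) -(coker_reprK v) -!coker_piD addrC.
Qed.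

Lemma coker_add0 : left_id (coker_pi_fun 0) coker_add.
Proof. by move=> u; rewrite -(coker_reprK u) -!coker_piD add0r. Qed.

Lemma coker_addN : left_inverse (coker_pi_fun 0) coker_opp coker_add.
Proof.
by move=> u; rewrite -(coker_reprK u) -!coker_piN -!coker_piD addNr.
Qed.

HB.instance Definition _ :=
  GRing.isZmodule.Build coker coker_addA coker_addC coker_add0 coker_addN.

Lemma coker_piDE x y :
  coker_pi_fun (x + y) = coker_pi_fun x + coker_pi_fun y.
Proof. exact: coker_piD. Qed.

Lemma coker_scaleA a b u : coker_scale a (coker_scale b u) = coker_scale (a * b) u.
Proof. by rewrite -(coker_reprK u) -!coker_piZ scalerA. Qed.

Lemma coker_scale1 : left_id 1 coker_scale.
Proof. by move=> u; rewrite -(coker_reprK u) -!coker_piZ scale1r. Qed.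

Lemma coker_scaleDr : right_distributive coker_scale +%R.
Proof.
move=> a u v; rewrite -(coker_reprK u) -(coker_reprK v).
by rewrite -coker_piDE -!coker_piZ -coker_piDE scalerDr.
Qed.

Lemma coker_scaleDl u : {morph coker_scale^~ u : a b / a + b}.
Proof.
move=> a b; rewrite -(coker_reprK u).
by rewrite -!coker_piZ -coker_piDE scalerDl.
Qed.

HB.instance Definition _ := GRing.Zmodule_isLmodule.Build A coker
  coker_scaleA coker_scale1 coker_scaleDr coker_scaleDl.

Lemma coker_pi_linear : linear coker_pi_fun.
Proof. by move=> a x y; rewrite coker_piDE coker_piZ. Qed.

Definition coker_pi : {linear N -> coker} := mklin coker_pi_linear.

Lemma coker_pi_surj : surjective_lin coker_pi.
Proof. by move=> u; exists (coker_repr u); apply: coker_reprK. Qed.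

Lemma coker_pi0 y : coker_pi y = 0 <-> exists x, f x = y.
Proof.
by rewrite -(linear0 coker_pi); split=> [/coker_piP|h];
  last apply/coker_piP; rewrite subr0.
Qed.

End Cokernel.

Section Induced.
Variables (A : pzRingType) (P M N : lmodType A) (p : {linear P -> M}).
Hypothesis p_surj : surjective_lin p.
Variables (f : {linear P -> N}) (fp : forall x, p x = 0 -> f x = 0).

Lemma induced_ex : exists g : {linear M -> N}, forall x, g (p x) = f x.
Proof.
pose s y := projT1 (cid (p_surj y)).
have sK y : p (s y) = y by rewrite /s; case: cid.
have fE x y : p x = p y -> f x = f y.
  move=> e; apply/eqP; rewrite -subr_eq0 -linearB; apply/eqP/fp.
  by rewrite linearB e subrr.
have lg : linear (f \o s).
  by move=> a x y /=; rewrite -linearP; apply: fE; rewrite linearP !sK.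
by exists (mklin lg) => x; apply: fE; rewrite sK.
Qed.
End Induced.

(* The duality (-)^* exchanges modules over a ring and over its opposite.  As
   (L^c)^c is not convertible to L, it is set up for a pair of anti-isomorphic
   rings, and used below for the identity maps between L and L^c. *)
Record antiiso (A B : pzRingType) := Antiiso {
  ai : A -> B;
  ai_inv : B -> A;
  aiK : cancel ai ai_inv;
  ai_invK : cancel ai_inv ai;
  aiD : {morph ai : x y / x + y};
  aiM : forall x y, ai (x * y) = ai y * ai x;
  ai1 : ai 1 = 1 }.

Section AntiisoTheory.
Variables (A B : pzRingType) (o : antiiso A B).

Lemma ai_invD : {morph ai_inv o : x y / x + y}.
Proof. by move=> x y; apply: (can_inj (aiK o)); rewrite aiD !ai_invK. Qed.
Lemma ai_invM x y : ai_inv o (x * y) = ai_inv o y * ai_inv o x.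
Proof. by apply: (can_inj (aiK o)); rewrite aiM !ai_invK. Qed.
Lemma ai_inv1 : ai_inv o 1 = 1.
Proof. by apply: (can_inj (aiK o)); rewrite ai1 !ai_invK. Qed.

Lemma ai0 : ai o 0 = 0.
Proof. by apply: (addrI (ai o 0)); rewrite -aiD !addr0. Qed.
Lemma ai_sum (I : finType) (F : I -> A) :
  ai o (\sum_i F i) = \sum_i ai o (F i).
Proof. by elim/big_rec2: _ => [|i y x _ <-]; [apply: ai0|rewrite aiD]. Qed.

Definition antiiso_sym : antiiso B A :=
  Antiiso (ai_invK o) (aiK o) ai_invD ai_invM ai_inv1.
End AntiisoTheory.

Definition dual (A B : pzRingType) (o : antiiso A B) (M : lmodType A) : Type :=
  {linear M -> A^o}.

Section Dual.
Variables (A B : pzRingType) (o : antiiso A B) (M : lmodType A).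
Local Notation dual := (dual o M).

HB.instance Definition _ := gen_eqMixin dual.
HB.instance Definition _ := gen_choiceMixin dual.

Definition dapp (phi : dual) (x : M) : A := (phi : {linear M -> A^o}) x.

Lemma dapp_inj (phi psi : dual) : dapp phi =1 dapp psi -> phi = psi.
Proof.
case: phi psi => [f cf] [g cg] /= e; have {}e : f = g by apply: funext.
case: _ / e in cg *; congr GRing.Linear.Pack.
case: cf cg => [[mD] [mZ] ] [[mD'] [mZ'] ].
by rewrite (Prop_irrelevance mD mD') (Prop_irrelevance mZ mZ').
Qed.

Lemma dapp_linear (phi : dual) : linear (dapp phi : M -> A^o).
Proof. exact: linearP. Qed.

Lemma dappD phi x y : dapp phi (x + y) = dapp phi x + dapp phi y.
Proof. exact: (linearD (phi : {linear M -> A^o})). Qed.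

Lemma dappZ phi a x : dapp phi (a *: x) = a * dapp phi x.
Proof. exact: (linearZ_LR (phi : {linear M -> A^o})). Qed.

Lemma dapp0 phi : dapp phi 0 = 0.
Proof. exact: (linear0 (phi : {linear M -> A^o})). Qed.

Lemma dappB phi x y : dapp phi (x - y) = dapp phi x - dapp phi y.
Proof. exact: (linearB (phi : {linear M -> A^o})). Qed.

Lemma dapp_sum phi (I : finType) (F : I -> M) :
  dapp phi (\sum_i F i) = \sum_i dapp phi (F i).
Proof. exact: (linear_sum (phi : {linear M -> A^o})). Qed.

Lemma dual0_linear : linear (fun _ : M => 0 : A^o).
Proof. by move=> a x y; rewrite scaler0 addr0. Qed.

Lemma dualD_linear (phi psi : dual) :
  linear (fun x => dapp phi x + dapp psi x : A^o).
Proof. by move=> a x y; rewrite !dappD !dappZ scalerDr addrACA. Qed.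

Lemma dualN_linear (phi : dual) : linear (fun x => - dapp phi x : A^o).
Proof. by move=> a x y; rewrite !dappD !dappZ scalerN opprD. Qed.

Lemma dualZ_linear (b : B) (phi : dual) :
  linear (fun x => dapp phi x * ai_inv o b : A^o).
Proof. by move=> a x y; rewrite dappD dappZ mulrDl -mulrA. Qed.

Definition dual0 : dual := mklin dual0_linear.
Definition dualD phi psi : dual := mklin (dualD_linear phi psi).
Definition dualN phi : dual := mklin (dualN_linear phi).
Definition dualZ b phi : dual := mklin (dualZ_linear b phi).

Lemma dualDA : associative dualD.
Proof. by move=> f g h; apply: dapp_inj => x; apply: addrA. Qed.
Lemma dualDC : commutative dualD.
Proof. by move=> f g; apply: dapp_inj => x; apply: addrC. Qed.
Lemma dualD0 : left_id dual0 dualD.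
Proof. by move=> f; apply: dapp_inj => x; apply: add0r. Qed.
Lemma dualDN : left_inverse dual0 dualN dualD.
Proof. by move=> f; apply: dapp_inj => x; apply: addNr. Qed.

HB.instance Definition _ := GRing.isZmodule.Build dual dualDA dualDC dualD0 dualDN.

Lemma dualZA a b phi : dualZ a (dualZ b phi) = dualZ (a * b) phi.
Proof.
by apply: dapp_inj => x; rewrite /dapp /= /dapp /= ai_invM mulrA.
Qed.
Lemma dualZ1 : left_id 1 dualZ.
Proof. by move=> f; apply: dapp_inj => x; rewrite /dapp /= ai_inv1 mulr1. Qed.
Lemma dualZDr : right_distributive dualZ +%R.
Proof. by move=> b f g; apply: dapp_inj => x; apply: mulrDl. Qed.
Lemma dualZDl f : {morph dualZ^~ f : a b / a + b}.
Proof.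
move=> a b; apply: dapp_inj => x.
by rewrite /dapp /= ai_invD mulrDr.
Qed.

HB.instance Definition _ :=
  GRing.Zmodule_isLmodule.Build B dual dualZA dualZ1 dualZDr dualZDl.

Lemma dappDl (phi psi : dual) x : dapp (phi + psi) x = dapp phi x + dapp psi x.
Proof. by []. Qed.
Lemma dappNl (phi : dual) x : dapp (- phi) x = - dapp phi x.
Proof. by []. Qed.
Lemma dapp0l x : dapp (0 : dual) x = 0.
Proof. by []. Qed.
Lemma dappZl b (phi : dual) x : dapp (b *: phi) x = dapp phi x * ai_inv o b.
Proof. by []. Qed.
Lemma dapp_suml (I : finType) (F : I -> dual) x :
  dapp (\sum_i F i) x = \sum_i dapp (F i) x.
Proof. by elim/big_rec2: _ => // i y phi _ <-. Qed.

End Dual.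

Section DualMap.
Variables (A B : pzRingType) (o : antiiso A B) (M N : lmodType A).
Variable f : {linear M -> N}.

Definition dmap_fun (phi : dual o N) : dual o M :=
  (phi : {linear N -> A^o}) \o f : {linear M -> A^o}.

Lemma dmap_linear : linear dmap_fun.
Proof. by move=> b phi psi; apply: dapp_inj. Qed.

Definition dmap : {linear dual o N -> dual o M} := mklin dmap_linear.

Lemma dmapE phi x : dapp (dmap phi) x = dapp phi (f x). Proof. by []. Qed.
End DualMap.

Section Evaluation.
Variables (A B : pzRingType) (o : antiiso A B) (M : lmodType A).

Lemma ev_fun_linear x : linear (fun phi : dual o M => ai o (dapp phi x) : B^o).
Proof.
move=> b phi psi; rewrite dappDl dappZl aiD aiM ai_invK.
by [].
Qed.

Definition ev_fun (x : M) : dual (antiiso_sym o) (dual o M) :=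
  mklin (ev_fun_linear x).

Lemma ev_linear : linear ev_fun.
Proof.
move=> a x y; apply: dapp_inj => phi.
by rewrite dappDl dappZl /dapp /= dappD dappZ aiD aiM.
Qed.

Definition ev : {linear M -> dual (antiiso_sym o) (dual o M)} := mklin ev_linear.

Lemma evE x phi : dapp (ev x) phi = ai o (dapp phi x). Proof. by []. Qed.
End Evaluation.
Arguments ev {A B} o {M}.

Section LinComb.
Variables (A : pzRingType) (M : lmodType A) (n : nat) (g : 'I_n -> M).

Lemma lincomb_linear : linear (fun c : 'rV[A]_n => \sum_i c 0 i *: g i).
Proof.
move=> a x y; rewrite scaler_sumr -big_split; apply: eq_bigr => i _ /=.
by rewrite !mxE scalerDl scalerA.
Qed.

Definition lincomb : {linear 'rV[A]_n -> M} := mklin lincomb_linear.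

Lemma lincomb_im x :
  (exists c : 'I_n -> A, x = \sum_i c i *: g i) <-> exists w, lincomb w = x.
Proof.
split=> [[c ->]|[w <-]].
  by exists (\row_i c i); apply: eq_bigr => i _; rewrite mxE.
by exists (fun i => w 0 i).
Qed.
End LinComb.

Section DualBasis.
Variables (A : pzRingType).

Definition dual_basis (P : lmodType A) n (e : 'I_n -> P)
  (phi : 'I_n -> {linear P -> A^o}) := forall x, x = \sum_i (phi i x : A) *: e i.

Lemma coord_linear n (i : 'I_n) : linear (fun x : 'rV[A]_n => x 0 i : A^o).
Proof. by move=> a x y; rewrite !mxE. Qed.

Lemma fgprojP (P : lmodType A) :
  fgproj P <-> exists n e phi, @dual_basis P n e phi.
Proof.
split=> [[[n [g gP]] pP]|[n [e [phi eP]]]].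
  have sg : surjective_lin (lincomb g).
    by move=> y; apply/lincomb_im; apply/gP.
  have [h hP] := pP _ _ (lincomb g) idfun sg.
  exists n, g, (fun i => mklin (coord_linear i) \o h : {linear P -> A^o}) => x.
  by rewrite -{1}[x]hP.
split; first by exists n, e => x; split=> // _; exists (fun i => phi i x).
move=> M N g f gs; pose y i := projT1 (cid (gs (f (e i)))).
have yP i : g (y i) = f (e i) by rewrite /y; case: cid.
have lh : linear (fun x => \sum_i (phi i x : A) *: y i).
  move=> a u v; rewrite scaler_sumr -big_split; apply: eq_bigr => i _ /=.
  by rewrite linearP scalerDl scalerA.
exists (mklin lh) => x; rewrite mklinE linear_sum [in RHS](eP x) linear_sum.
by apply: eq_bigr => i _; rewrite !linearZ /= yP.
Qed.

Lemma fgproj_row n : fgproj 'rV[A]_n.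
Proof.
apply/fgprojP.
exists n, (fun i => delta_mx 0 i), (fun i => mklin (coord_linear i)).
by move=> x; rewrite {1}[x]row_sum_delta.
Qed.

Lemma lift_im (P M N : lmodType A) (b : {linear M -> N}) (a : {linear P -> N}) :
  projective P -> (forall x, exists y, b y = a x) ->
  exists h : {linear P -> M}, forall x, b (h x) = a x.
Proof.
move=> pP ab; have ld : linear (fun u : P * M => a u.1 - b u.2).
  move=> c u v; rewrite /= !linearP scalerBr /=.
  by rewrite scalerN addrACA.
pose d := mklin ld.
have l1 : linear (fun u : ker d => (ker_inc d u).1) by [].
have l2 : linear (fun u : ker d => (ker_inc d u).2) by [].
have s1 : surjective_lin (mklin l1).
  move=> x; have [y yE] := ab x.
  have [u uE] : exists u : ker d, ker_inc d u = (x, y).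
    by apply: ker_inc_ex; rewrite mklinE /= yE subrr.
  by exists u; rewrite mklinE uE.
have [h hE] := pP _ _ (mklin l1) idfun s1.
exists (mklin l2 \o h : {linear P -> M}) => x /=.
have /eqP := ker_incP (h x); rewrite mklinE subr_eq0 => /eqP <-.
by congr (a _); apply: hE.
Qed.
End DualBasis.

Section DualProj.
Variables (A B : pzRingType) (o : antiiso A B) (P : lmodType A).
Hypothesis pP : fgproj P.

Lemma dual_fgproj : fgproj (dual o P).
Proof.
have /fgprojP[n [e [phi eP]]] := pP; apply/fgprojP.
exists n, phi, (fun i => ev o (e i)) => psi; apply: dapp_inj => x.
rewrite [in LHS](eP x) dapp_sum dapp_suml; apply: eq_bigr => i _.
by rewrite dappZ dappZl /= /dapp /= aiK.
Qed.

Lemma ev_inj : injective (@ev _ _ o P).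
Proof.
have /fgprojP[n [e [phi eP]]] := pP.
move=> x y exy; rewrite (eP x) (eP y); apply: eq_bigr => i _; congr (_ *: _).
have := congr1 (fun psi => dapp psi (phi i : dual o P)) exy.
by rewrite !evE => /(can_inj (aiK o)).
Qed.

Lemma ev_surj : surjective_lin (@ev _ _ o P).
Proof.
have /fgprojP[n [e [phi eP]]] := pP.
move=> psi; exists (\sum_i ai_inv o (dapp psi (phi i : dual o P)) *: e i).
apply: dapp_inj => chi; rewrite evE.
have chiE : chi = \sum_i (ai o (dapp chi (e i)) : B) *: (phi i : dual o P).
  apply: dapp_inj => x; rewrite [in LHS](eP x) dapp_sum dapp_suml.
  by apply: eq_bigr => i _; rewrite dappZ dappZl aiK.
rewrite [in RHS]chiE !dapp_sum ai_sum; apply: eq_bigr => i _.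
by rewrite !dappZ aiM ai_invK.
Qed.
End DualProj.

Section Noeth.
Variables (A : pzRingType) (nA : left_noetherian A).

Definition noeth_mod (M : lmodType A) : Prop :=
  forall U : M -> Prop, submodule U -> fg_sub U.

Lemma fg_subP (M : lmodType A) (U : M -> Prop) :
  fg_sub U <-> exists n (q : {linear 'rV[A]_n -> M}),
    forall x, U x <-> exists w, q w = x.
Proof.
split=> [[n [g gP]]|[n [q qP]]].
  exists n, (lincomb g) => x; split=> [/gP|h]; first by move/lincomb_im.
  by apply/gP/lincomb_im.
exists n, (fun i => q (delta_mx 0 i)) => x.
have qE w : q w = \sum_i w 0 i *: q (delta_mx 0 i).
  rewrite {1}[w]row_sum_delta linear_sum; apply: eq_bigr => i _.
  by rewrite linearZ.
split=> [/qP[w <-]|[c ->]]; first by exists (fun i => w 0 i).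
apply/qP; exists (\row_i c i); rewrite qE.
by apply: eq_bigr => i _; rewrite mxE.
Qed.

Lemma fg_sub_comb (M : lmodType A) (U : M -> Prop) n (g : 'I_n -> M) c :
  submodule U -> (forall i, U (g i)) -> U (\sum_i c i *: g i).
Proof.
move=> [U0 UP] Ug; elim/big_rec: _ => // i x _ Ux; exact: UP.
Qed.

Lemma submodD (M : lmodType A) (U : M -> Prop) x y :
  submodule U -> U x -> U y -> U (x + y).
Proof. by move=> [_ UP] Ux Uy; rewrite -[x]scale1r; apply: UP. Qed.

Lemma submodB (M : lmodType A) (U : M -> Prop) x y :
  submodule U -> U x -> U y -> U (x - y).
Proof. by move=> [_ UP] Ux Uy; rewrite addrC -scaleN1r; apply: UP. Qed.

Lemma noeth_ext (M N : lmodType A) (f : {linear M -> N}) (U : M -> Prop) :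
  submodule U -> fg_sub (fun y => exists2 x, U x & f x = y) ->
  fg_sub (fun x => U x /\ f x = 0) -> fg_sub U.
Proof.
move=> sU [m [g gP]] [n [h hP]].
have Ug i : exists2 x, U x & f x = g i.
  apply/gP; exists (fun j => (j == i)%:R); rewrite (bigD1 i) //= eqxx scale1r.
  by rewrite big1 ?addr0 // => j /negPf->; rewrite scale0r.
pose k i := s2val (cid2 (Ug i)).
have kU i : U (k i) by rewrite /k; case: cid2.
have kg i : f (k i) = g i by rewrite /k; case: cid2.
have Uh i : U (h i) /\ f (h i) = 0.
  apply/hP; exists (fun j => (j == i)%:R); rewrite (bigD1 i) //= eqxx scale1r.
  by rewrite big1 ?addr0 // => j /negPf->; rewrite scale0r.
exists (m + n)%N, (fun i => match split i with inl j => k j | inr j => h j end).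
move=> x; split=> [Ux|[c ->]]; last first.
  by apply: fg_sub_comb => // i; case: split => j; [apply: kU|case: (Uh j)].
have [c cE] : exists c : 'I_m -> A, f x = \sum_i c i *: g i.
  by apply/gP; exists x.
have [d dE] : exists d : 'I_n -> A, x - \sum_i c i *: k i = \sum_i d i *: h i.
  apply/hP; split; first by apply: submodB => //; apply: fg_sub_comb.
  rewrite linearB linear_sum cE; apply/eqP; rewrite subr_eq0; apply/eqP.
  by apply: eq_bigr => i _; rewrite linearZ /= kg.
exists (fun i => match split i with inl j => c j | inr j => d j end).
rewrite big_split_ord -[LHS](subrK (\sum_i c i *: k i)) dE addrC.
congr (_ + _); apply: eq_bigr => i _.
  by have := unsplitK (inl i : 'I_m + 'I_n) => /= ->.
by have := unsplitK (inr i : 'I_m + 'I_n) => /= ->.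
Qed.

Lemma fg_sub_im (M N : lmodType A) (f : {linear M -> N}) (U : M -> Prop) :
  fg_sub U -> fg_sub (fun y => exists2 x, U x & f x = y).
Proof.
move=> /fg_subP[n [q qP]]; apply/fg_subP; exists n, (f \o q : {linear _ -> _}).
move=> y; split=> [[x /qP[w <-] <-]|[w <-]]; first by exists w.
by exists (q w) => //; apply/qP; exists w.
Qed.

Lemma submod_preim (M N : lmodType A) (f : {linear M -> N}) (U : N -> Prop) :
  submodule U -> submodule (fun x => U (f x)).
Proof.
move=> [U0 UP]; split=> [|a x y Ux Uy]; first by rewrite linear0.
by rewrite linearP; apply: UP.
Qed.

Lemma submod_im (M N : lmodType A) (f : {linear M -> N}) (U : M -> Prop) :
  submodule U -> submodule (fun y => exists2 x, U x & f x = y).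
Proof.
move=> [U0 UP]; split=> [|a _ _ [x Ux <-] [y Uy <-]].
  by exists 0 => //; rewrite linear0.
by exists (a *: x + y); [apply: UP|rewrite linearP].
Qed.

Lemma noeth_row n : noeth_mod 'rV[A]_n.
Proof.
elim: n => [|n IHn] U sU.
  exists 0%N, (fun _ => 0) => x; rewrite [x]thinmx0; split=> _.
    by exists (fun _ => 0); rewrite big_ord0.
  by case: sU.
pose f : {linear 'rV[A]_n.+1 -> A^o} := mklin (@coord_linear A n.+1 0).
apply: (noeth_ext (f := f)) => //; first exact: nA (submod_im f sU).
pose r (x : 'rV[A]_n) : 'rV[A]_n.+1 :=
  \row_i (if unlift 0 i is Some j then x 0 j else 0).
have lr : linear r.
  move=> a x y; apply/rowP => i; rewrite !mxE.
  by case: unlift => [j|]; rewrite ?mxE ?mulr0 ?addr0.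
have := fg_sub_im (mklin lr) (IHn _ (submod_preim (mklin lr) sU)).
congr fg_sub; apply: funext => x; apply: propext; split=> [[y Uy <-]|[Ux fx]].
  by split=> //; rewrite /f !mklinE mxE unlift_none.
have xE : r (\row_j x 0 (lift 0 j)) = x.
  apply/rowP => i; rewrite mxE; case: unliftP => [j ->|->]; first by rewrite mxE.
  by rewrite -fx.
by exists (\row_j x 0 (lift 0 j)); rewrite mklinE xE.
Qed.

Lemma ker_cover (M N : lmodType A) (f : {linear M -> N}) :
  finitely_generated M -> exists n (q : {linear 'rV[A]_n -> M}),
    forall x, f x = 0 <-> exists w, q w = x.
Proof.
move=> /fg_subP[m [p pP]].
have sU : submodule (fun w => f (p w) = 0).
  split=> [|a x y fx fy]; first by rewrite !linear0.
  by rewrite !linearP fx fy scaler0 addr0.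
have /fg_subP[n [q qP]] := fg_sub_im p (noeth_row sU).
exists n, q => x; rewrite -qP; split=> [fx|[w ? <-] //].
by have [w wx] := (pP x).1 I; exists w; rewrite ?wx.
Qed.
End Noeth.

Section ProjProd.
Variables (A : pzRingType) (P Q : lmodType A).

Lemma fgproj_prod : fgproj P -> fgproj Q -> fgproj (P * Q)%type.
Proof.
move=> [/fg_subP[m [p pP]] prP] [/fg_subP[n [q qP]] prQ]; split.
  apply/fg_subP; exists (m + n)%N.
  have l : linear (fun w : 'rV[A]_(m + n) => (p (lsubmx w), q (rsubmx w))).
    by move=> a x y; rewrite !linearP.
  exists (mklin l) => -[x y]; split=> // _.
  have [u uE] := (pP x).1 I; have [v vE] := (qP y).1 I.
  by exists (row_mx u v); rewrite mklinE row_mxKl row_mxKr uE vE.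
move=> M N g f gs.
have l1 : linear (fun x : P => f (x, 0)).
  move=> a x y; rewrite -linearP; congr (f _).
  by rewrite -[RHS]/(a *: x + y, a *: (0 : Q) + 0) scaler0 addr0.
have l2 : linear (fun y : Q => f (0, y)).
  move=> a x y; rewrite -linearP; congr (f _).
  by rewrite -[RHS]/(a *: (0 : P) + 0, a *: x + y) scaler0 addr0.
have [h1 h1E] := prP _ _ g (mklin l1) gs.
have [h2 h2E] := prQ _ _ g (mklin l2) gs.
have l : linear (fun u : P * Q => h1 u.1 + h2 u.2).
  by move=> a x y /=; rewrite !linearP scalerDr addrACA.
exists (mklin l) => -[x y]; rewrite mklinE /= linearD h1E h2E !mklinE -linearD.
by congr (f _); rewrite -[LHS]/(x + 0, 0 + y) addr0 add0r.
Qed.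
End ProjProd.

(* A finitely presented module, together with a presentation
   gen1 -> gen0 -> car -> 0 by finitely generated projectives.  Morphisms (see
   stmod) only see the underlying module. *)
Record fpmod (A : pzRingType) := FPMod {
  car :> lmodType A;
  gen1 : lmodType A;
  gen0 : lmodType A;
  gen1P : fgproj gen1;
  gen0P : fgproj gen0;
  pd : {linear gen1 -> gen0};
  pp : {linear gen0 -> car};
  pp_surj : surjective_lin pp;
  pp_exact : forall x, pp x = 0 <-> exists y, pd y = x }.

Lemma pp_pd A (M : fpmod A) x : pp M (pd M x) = 0.
Proof. by apply/pp_exact; exists x. Qed.

Section Stable.
Variable A : pzRingType.

Definition stable_eq (M N : lmodType A) (f g : {linear M -> N}) : Prop :=
  exists P : lmodType A, fgproj P /\
    exists (u : {linear M -> P}) (v : {linear P -> N}),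
      forall x, f x - g x = v (u x).

Lemma stable_eq_ext (M N : lmodType A) (f g : {linear M -> N}) :
  (forall x, f x = g x) -> stable_eq f g.
Proof.
move=> fg; exists 'rV[A]_0; split; first exact: fgproj_row.
have l1 : linear (fun _ : M => 0 : 'rV[A]_0) by move=> a x y; rewrite scaler0 addr0.
have l2 : linear (fun _ : 'rV[A]_0 => 0 : N) by move=> a x y; rewrite scaler0 addr0.
by exists (mklin l1), (mklin l2) => x; rewrite fg subrr.
Qed.

Lemma stable_eq_refl (M N : lmodType A) (f : {linear M -> N}) : stable_eq f f.
Proof. exact: stable_eq_ext. Qed.

Lemma stable_eq_sym (M N : lmodType A) (f g : {linear M -> N}) :
  stable_eq f g -> stable_eq g f.
Proof.
move=> [P [pP [u [v uv]]]]; exists P; split=> //.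
have l : linear (fun x => - v x) by move=> a x y; rewrite linearP opprD scalerN.
by exists u, (mklin l) => x; rewrite mklinE -uv opprB.
Qed.

Lemma stable_eq_trans (M N : lmodType A) (f g h : {linear M -> N}) :
  stable_eq f g -> stable_eq g h -> stable_eq f h.
Proof.
move=> [P [pP [u [v uv]]]] [Q [pQ [u' [v' uv']]]].
exists (P * Q)%type; split; first exact: fgproj_prod.
have l1 : linear (fun x => (u x, u' x)) by move=> a x y; rewrite !linearP.
have l2 : linear (fun z : P * Q => v z.1 + v' z.2).
  by move=> a x y /=; rewrite !linearP scalerDr addrACA.
exists (mklin l1), (mklin l2) => x.
by rewrite !mklinE /= -uv -uv' addrA subrK.
Qed.

Lemma stable_eq_comp (X Y Z : lmodType A) (g g' : {linear Y -> Z})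
    (f f' : {linear X -> Y}) :
  stable_eq g g' -> stable_eq f f' -> stable_eq (g \o f) (g' \o f').
Proof.
move=> [P [pP [u [v uv]]]] [Q [pQ [u' [v' uv']]]].
apply: (@stable_eq_trans _ _ _ (g' \o f)).
  by exists P; split=> //; exists (u \o f), v => x; rewrite -uv.
exists Q; split=> //; exists u', (g' \o v') => x.
by rewrite /= -uv' linearB.
Qed.

Definition stmod : category :=
  @Cat (fpmod A) (fun M N => {linear M -> N}) (fun M N => @stable_eq M N)
    (fun M => idfun) (fun X Y Z g f => g \o f)
    (fun M N => @stable_eq_refl M N) (fun M N => @stable_eq_sym M N)
    (fun M N => @stable_eq_trans M N) (fun X Y Z => @stable_eq_comp X Y Z)
    (fun X Y Z T h g f => stable_eq_refl (h \o (g \o f)))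
    (fun X Y f => stable_eq_refl f) (fun X Y f => stable_eq_refl f).
End Stable.

Section LinOps.
Variables (A : pzRingType) (M N : lmodType A).
Lemma subl_linear (f g : {linear M -> N}) : linear (fun x => f x - g x).
Proof. by move=> a x y; rewrite !linearP scalerBr /= scalerN addrACA. Qed.
Definition subl (f g : {linear M -> N}) : {linear M -> N} := mklin (subl_linear f g).
Lemma sublE f g x : subl f g x = f x - g x. Proof. by []. Qed.
End LinOps.

Section Omega.
Variables (A : pzRingType) (nA : left_noetherian A).

Section Object.
Variable M : fpmod A.

Definition omega_rank : nat := projT1 (cid (ker_cover nA (pd M) (proj1 (gen1P M)))).
Definition omega_rel : {linear 'rV[A]_omega_rank -> gen1 M} :=
  projT1 (cid (projT2 (cid (ker_cover nA (pd M) (proj1 (gen1P M)))))).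

Lemma omega_relP x : pd M x = 0 <-> exists w, omega_rel w = x.
Proof. exact: (projT2 (cid (projT2 (cid (ker_cover nA (pd M) (proj1 (gen1P M))))))). Qed.

Definition omega_gen : {linear gen1 M -> ker (pp M)} := ker_lift (@pp_pd A M).

Lemma omega_gen_surj : surjective_lin omega_gen.
Proof.
move=> x; have [y yx] := (pp_exact _).1 (ker_incP x).
by exists y; apply: ker_inc_inj; rewrite ker_liftE.
Qed.

Lemma omega_exact x : omega_gen x = 0 <-> exists w, omega_rel w = x.
Proof.
rewrite -omega_relP -(ker_liftE (@pp_pd A M)) -/omega_gen.
split=> [->|e]; first exact: linear0.
by apply: ker_inc_inj; rewrite e linear0.
Qed.

(* The kernel of gen0 M -> M. *)
Definition omega : fpmod A :=
  @FPMod A (ker (pp M)) 'rV[A]_omega_rank (gen1 M) (fgproj_row A _) (gen1P M)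
    omega_rel omega_gen omega_gen_surj omega_exact.
End Object.

(* g is induced on syzygies by a lift h of f to the projective covers. *)
Definition omega_of (M N : fpmod A) (f : {linear M -> N})
    (g : {linear omega M -> omega N}) : Prop :=
  exists h : {linear gen0 M -> gen0 N},
    (forall x, pp N (h x) = f (pp M x)) /\
    (forall x, ker_inc (pp N) (g x) = h (ker_inc (pp M) x)).

Lemma omega_of_lift (M N : fpmod A) (f : {linear M -> N})
    (h : {linear gen0 M -> gen0 N}) : (forall x, pp N (h x) = f (pp M x)) ->
  exists g : {linear omega M -> omega N},
    forall x, ker_inc (pp N) (g x) = h (ker_inc (pp M) x).
Proof.
move=> hP; have h0 x : pp N ((h \o ker_inc (pp M)) x) = 0.
  by rewrite /= hP ker_incP linear0.
by exists (ker_lift h0).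
Qed.

Lemma omega_map_ex (M N : fpmod A) (f : {linear M -> N}) :
  exists g, omega_of f g.
Proof.
have [h hP] := proj2 (gen0P M) _ _ (pp N) (f \o pp M) (@pp_surj A N).
by have [g gP] := omega_of_lift hP; exists g, h.
Qed.

Lemma omega_of_eq (M N : fpmod A) (f f' : {linear M -> N}) g g' :
  stable_eq f f' -> omega_of f g -> omega_of f' g' -> stable_eq g g'.
Proof.
move=> [P [[_ pP] [u [v uv]]]] [h [hP gP]] [h' [hP' gP']].
have [w wP] := pP _ _ (pp N) v (@pp_surj A N).
pose k := subl (subl h h') (w \o u \o pp M).
have k0 x : pp N (k x) = 0.
  by rewrite !sublE /= !linearB hP hP' wP -uv subrr.
exists (gen0 M); split; first exact: gen0P.
exists (ker_inc (pp M)), (ker_lift k0) => x.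
apply: ker_inc_inj; rewrite ker_liftE linearB gP gP' !sublE /= ker_incP.
by rewrite !linear0 addr0.
Qed.

Definition omega_map (M N : fpmod A) (f : {linear M -> N}) :
  {linear omega M -> omega N} := projT1 (cid (omega_map_ex f)).

Lemma omega_mapP (M N : fpmod A) (f : {linear M -> N}) : omega_of f (omega_map f).
Proof. by rewrite /omega_map; case: cid. Qed.

Lemma omega_of_id (M : fpmod A) : omega_of (@idfun M) idfun.
Proof. by exists idfun. Qed.

Lemma omega_of_comp (X Y Z : fpmod A) (g : {linear Y -> Z}) (f : {linear X -> Y})
  f' g' : omega_of f f' -> omega_of g g' -> omega_of (g \o f) (g' \o f').
Proof.
move=> [h [hP fP]] [k [kP gP]]; exists (k \o h).
by split=> x; [rewrite /= kP hP|rewrite -[RHS]/(k (h _)) -fP -gP].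
Qed.

Definition Omega : functor (stmod A) (stmod A) :=
  @Functor (stmod A) (stmod A) omega omega_map
    (fun M N f g e => omega_of_eq e (omega_mapP f) (omega_mapP g))
    (fun M => omega_of_eq (stable_eq_refl _) (omega_mapP _) (omega_of_id M))
    (fun X Y Z g f => omega_of_eq (stable_eq_refl _) (omega_mapP (g \o f))
       (omega_of_comp (omega_mapP f) (omega_mapP g))).
End Omega.

Section Transpose.
Variables (A B : pzRingType) (o : antiiso A B).

(* The cokernel of the dual of gen1 M -> gen0 M. *)
Definition transp (M : fpmod A) : fpmod B :=
  @FPMod B (coker (dmap o (pd M))) (dual o (gen0 M)) (dual o (gen1 M))
    (dual_fgproj o (gen0P M)) (dual_fgproj o (gen1P M))
    (dmap o (pd M)) (coker_pi (dmap o (pd M)))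
    (@coker_pi_surj _ _ _ _) (@coker_pi0 _ _ _ _).

(* g is induced on transposes by a lift (h1, h0) of f to the presentations. *)
Definition transp_of (M N : fpmod A) (f : {linear M -> N})
    (g : {linear transp N -> transp M}) : Prop :=
  exists (h0 : {linear gen0 M -> gen0 N}) (h1 : {linear gen1 M -> gen1 N}),
    [/\ forall x, pp N (h0 x) = f (pp M x),
        forall x, pd N (h1 x) = h0 (pd M x) &
        forall phi, g (pp (transp N) phi) = pp (transp M) (dmap o h1 phi)].

Lemma transp_of_lift (M N : fpmod A) (h0 : {linear gen0 M -> gen0 N})
    (h1 : {linear gen1 M -> gen1 N}) : (forall x, pd N (h1 x) = h0 (pd M x)) ->
  exists g : {linear transp N -> transp M},
    forall phi, g (pp (transp N) phi) = pp (transp M) (dmap o h1 phi).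
Proof.
move=> h1P; apply: (induced_ex (@pp_surj _ (transp N))
  (f := pp (transp M) \o dmap o h1)) => phi /pp_exact[psi <-].
apply/(@pp_exact _ (transp M)); exists (dmap o h0 psi).
by apply: dapp_inj => x; rewrite !dmapE h1P.
Qed.

Lemma transp_map_ex (M N : fpmod A) (f : {linear M -> N}) :
  exists g, transp_of f g.
Proof.
have [h0 h0P] := proj2 (gen0P M) _ _ (pp N) (f \o pp M) (@pp_surj A N).
have [h1 h1P] : exists h1 : {linear gen1 M -> gen1 N},
    forall x, pd N (h1 x) = (h0 \o pd M) x.
  apply: lift_im => [|x]; first exact: proj2 (gen1P M).
  by apply/pp_exact; rewrite /= h0P /= pp_pd linear0.
by have [g gP] := transp_of_lift h1P; exists g, h0, h1.
Qed.

Lemma transp_of_eq (M N : fpmod A) (f f' : {linear M -> N}) g g' :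
  stable_eq f f' -> transp_of f g -> transp_of f' g' -> stable_eq g g'.
Proof.
move=> [P [[_ pP] [u [v uv]]]] [h0 [h1 [h0P h1P gP]]] [k0 [k1 [k0P k1P gP']]].
have [w wP] := pP _ _ (pp N) v (@pp_surj A N).
pose k := subl (subl h0 k0) (w \o u \o pp M).
have kk0 x : pp N (k x) = 0.
  by rewrite !sublE /= !linearB h0P k0P wP -uv subrr.
have [t tP] : exists t : {linear gen0 M -> gen1 N}, forall x, pd N (t x) = k x.
  apply: lift_im => [|x]; first exact: proj2 (gen0P M).
  by apply/pp_exact; apply: kk0.
pose s := subl (subl h1 k1) (t \o pd M).
have s0 x : pd N (s x) = 0.
  rewrite !sublE /= !linearB h1P k1P tP !sublE /= pp_pd !linear0 addr0.
  by rewrite subrr.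
have [r rP] : exists r : {linear transp N -> dual o (gen1 M)},
    forall phi, r (pp (transp N) phi) = dmap o s phi.
  apply: induced_ex; first exact: (@pp_surj _ (transp N)).
  move=> phi /pp_exact[psi <-]; apply: dapp_inj => x.
  by rewrite !dmapE s0 dapp0.
exists (gen0 (transp M)); split; first exact: gen0P.
exists r, (pp (transp M)) => x.
have [phi <-] := @pp_surj _ (transp N) x.
rewrite gP gP' rP; apply/eqP; rewrite -linearB -subr_eq0 -linearB.
apply/eqP/(@pp_exact _ (transp M)); exists (dmap o t phi).
apply: dapp_inj => y; rewrite !dappDl !dappNl !dmapE !sublE /= !dappB.
by rewrite opprB addrC subrK.
Qed.

Definition transp_map (M N : fpmod A) (f : {linear M -> N}) :
  {linear transp N -> transp M} := projT1 (cid (transp_map_ex f)).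

Lemma transp_mapP (M N : fpmod A) (f : {linear M -> N}) :
  transp_of f (transp_map f).
Proof. by rewrite /transp_map; case: cid. Qed.

Lemma transp_of_id (M : fpmod A) : transp_of (@idfun M) idfun.
Proof.
by exists idfun, idfun; split=> // phi; congr (pp _ _); apply: dapp_inj.
Qed.

Lemma transp_of_comp (X Y Z : fpmod A) (g : {linear Y -> Z}) (f : {linear X -> Y})
  f' g' : transp_of f f' -> transp_of g g' -> transp_of (g \o f) (f' \o g').
Proof.
move=> [h0 [h1 [h0P h1P fP]]] [k0 [k1 [k0P k1P gP]]].
exists (k0 \o h0), (k1 \o h1); split=> [x|x|phi].
- by rewrite /= k0P h0P.
- by rewrite /= k1P h1P.
- by rewrite -[LHS]/(f' (g' _)) gP fP; congr (pp _ _); apply: dapp_inj.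
Qed.

Definition Tr : functor (stmod A) (opcat (stmod B)) :=
  @Functor (stmod A) (opcat (stmod B)) transp transp_map
    (fun M N f g e => transp_of_eq e (transp_mapP f) (transp_mapP g))
    (fun M => transp_of_eq (stable_eq_refl _) (transp_mapP _) (transp_of_id M))
    (fun X Y Z g f => transp_of_eq (stable_eq_refl _) (transp_mapP (g \o f))
       (transp_of_comp (transp_mapP f) (transp_mapP g))).
End Transpose.

Section Sigma.
Variables (A B : pzRingType) (o : antiiso A B).
Variables (nA : left_noetherian A) (nB : left_noetherian B).
Local Notation o' := (antiiso_sym o).

Definition Sigma : functor (stmod A) (stmod A) :=
  fcomp (fflip (Tr o')) (fcomp (fop (Omega nB)) (Tr o)).

Section Approx.
Variable X : fpmod A.
Local Notation S := (transp o' (omega nB (transp o X))).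
Local Notation q := (omega_rel nB (transp o X)).

(* The left approximation of X by projectives, on generators. *)
Definition approx : {linear gen0 X -> gen0 S} := dmap o' q \o @ev _ _ o (gen0 X).

Lemma approxE x w : dapp (approx x : dual o' _) w = ai o (dapp (q w) x).
Proof. by []. Qed.

Lemma approx_pp x : pp S (approx x) = 0.
Proof. exact: (@pp_pd _ S (ev o x)). Qed.

Lemma approx_im y : pp S y = 0 -> exists x, approx x = y.
Proof.
move=> /pp_exact[psi <-].
by have [x <-] := @ev_surj _ _ o _ (gen0P X) psi; exists x.
Qed.

Lemma approx_pd z : approx (pd X z) = 0.
Proof.
apply: dapp_inj => w; rewrite approxE dapp0l.
have qw : dmap o (pd X) (q w) = 0 by apply/(@omega_relP _ nB (transp o X) _); exists w.
by rewrite -dmapE qw ai0.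
Qed.

Lemma approx_univ (E : lmodType A) (g : {linear gen0 X -> E}) :
  fgproj E -> (forall z, g (pd X z) = 0) ->
  exists k : {linear gen0 S -> E}, forall x, k (approx x) = g x.
Proof.
move=> pE g0.
have [h hP] : exists h : {linear dual o E -> 'rV_(omega_rank nB (transp o X))},
    forall phi, q (h phi) = dmap o g phi.
  apply: lift_im => [|phi]; first exact: proj2 (dual_fgproj o pE).
  apply/omega_relP; apply: dapp_inj => z.
  by rewrite -[LHS]/(dapp phi (g (pd X z))) g0 dapp0.
have [k kP] := proj2 (gen0P S) _ _ (@ev _ _ o E) (dmap o' h) (@ev_surj _ _ o _ pE).
exists k => x; apply: (ev_inj pE (o := o)); rewrite kP.
by apply: dapp_inj => phi; rewrite dmapE approxE hP.
Qed.

Lemma eta1_ex : exists g : {linear X -> omega nA S},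
  forall x, g (pp X x) = ker_lift approx_pp x.
Proof.
apply: induced_ex; first exact: pp_surj.
move=> x /pp_exact[z <-]; apply: ker_inc_inj.
by rewrite ker_liftE linear0 approx_pd.
Qed.

Definition eta1 : {linear X -> omega nA S} := projT1 (cid eta1_ex).

Lemma eta1_pp x : eta1 (pp X x) = ker_lift approx_pp x.
Proof. exact: (projT2 (cid eta1_ex)). Qed.

Lemma eta1E x : ker_inc (pp S) (eta1 (pp X x)) = approx x.
Proof. by rewrite eta1_pp ker_liftE. Qed.
End Approx.

Lemma eta1_nat (X Y : stmod A) (f : hom X Y) :
  fmap (Omega nA) (fmap Sigma f) \oo (eta1 X : hom X (Omega nA (Sigma X)))
  =~ (eta1 Y : hom Y (Omega nA (Sigma Y))) \oo f.
Proof.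
pose SX := transp o' (omega nB (transp o X)).
pose SY := transp o' (omega nB (transp o Y)).
have [h0 [h1 [h0P h1P gP]]] := transp_mapP o f.
have [g2 g2P] := @omega_of_lift _ nB (transp o Y) (transp o X) _ (dmap o h1)
  (fun phi => esym (gP phi)).
have [h2 h2P] : exists h2 : {linear 'rV_(omega_rank nB (transp o Y)) ->
    'rV_(omega_rank nB (transp o X))},
    forall w, omega_rel nB (transp o X) (h2 w)
            = (dmap o h0 \o omega_rel nB (transp o Y)) w.
  apply: lift_im => [|w]; first exact: proj2 (fgproj_row _ _).
  apply/omega_relP; apply: dapp_inj => z.
  rewrite -[LHS]/(dapp (omega_rel nB (transp o Y) w) (h0 (pd X z))) -h1P -dmapE.
  have -> : dmap o (pd Y) (omega_rel nB (transp o Y) w) = 0.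
    by apply/(@omega_relP _ nB (transp o Y) _); exists w.
  by [].
have [g3 g3P] := @transp_of_lift _ _ o' (omega nB (transp o Y))
  (omega nB (transp o X)) (dmap o h0) h2 h2P.
have g23 : transp_of (o := o') g2 g3.
  exists (dmap o h0), h2; split=> // psi.
  apply: ker_inc_inj; rewrite g2P !ker_liftE.
  by apply: dapp_inj => z; rewrite !dmapE h1P.
have [g4 g4P] := @omega_of_lift _ nA SX SY _ (dmap o' h2) (fun phi => esym (g3P phi)).
have e3 : stable_eq (transp_map o' (omega_map nB (transp_map o f))) g3.
  apply: transp_of_eq (transp_mapP _ _) g23.
  apply: omega_of_eq (stable_eq_refl _) (omega_mapP _ _) _.
  by exists (dmap o h1); split=> [phi|]; [apply: esym (gP phi)|apply: g2P].
have e4 : stable_eq (omega_map nA (transp_map o' (omega_map nB (transp_map o f)))) g4.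
  apply: omega_of_eq e3 (omega_mapP _ _) _.
  by exists (dmap o' h2); split=> [phi|]; [apply: esym (g3P phi)|apply: g4P].
apply: stable_eq_trans (stable_eq_comp e4 (stable_eq_refl _)) _.
apply: stable_eq_ext => x; have [y <-] := pp_surj x.
apply: ker_inc_inj; rewrite -[X in ker_inc _ X]/(g4 _) g4P eta1E.
rewrite -[RHS]/(ker_inc (pp SY) (eta1 Y (f (pp X y)))) -h0P eta1E.
apply: dapp_inj => w; rewrite dmapE !approxE h2P.
by [].
Qed.

Lemma eta1_univ_ex (X Y : stmod A) (f : hom X (Omega nA Y)) :
  exists g : hom (Sigma X) Y,
    fmap (Omega nA) g \oo (eta1 X : hom X (Omega nA (Sigma X))) =~ f.
Proof.
have [k kP] := @approx_univ X _ (ker_inc (pp Y) \o f \o pp X) (gen0P Y)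
  (fun z => ltac:(by rewrite /= pp_pd linear0)).
have [g gP] : exists g : {linear Sigma X -> Y},
    forall z, g (pp (Sigma X) z) = (pp Y \o k) z.
  apply: induced_ex; first exact: pp_surj.
  by move=> y /approx_im[x <-]; rewrite /= kP; apply: ker_incP.
have [g' g'P] := @omega_of_lift _ nA (Sigma X) Y _ k (fun z => esym (gP z)).
exists g; have e : stable_eq (omega_map nA g) g'.
  by apply: omega_of_eq (stable_eq_refl _) (omega_mapP _ _) _;
    exists k; split=> [z|]; [apply: esym (gP z)|apply: g'P].
apply: stable_eq_trans (stable_eq_comp e (stable_eq_refl _)) _.
apply: stable_eq_ext => x; have [y <-] := pp_surj x.
apply: ker_inc_inj; rewrite -[X in ker_inc _ X]/(g' _) g'P eta1E.
exact: kP.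
Qed.

Lemma eta1_univ_uniq (X Y : stmod A) (g g' : hom (Sigma X) Y) :
  fmap (Omega nA) g \oo (eta1 X : hom X (Omega nA (Sigma X)))
  =~ fmap (Omega nA) g' \oo (eta1 X : hom X (Omega nA (Sigma X))) -> g =~ g'.
Proof.
move=> [P [pP [u [v uv]]]].
have [k [kP gk]] := omega_mapP nA g; have [k' [k'P gk']] := omega_mapP nA g'.
have [l lP] := @approx_univ X _ (u \o pp X) pP
  (fun z => ltac:(by rewrite /= pp_pd linear0)).
have [s sP] : exists s : {linear Sigma X -> gen0 Y}, forall z,
    s (pp (Sigma X) z) = subl (subl k k') (ker_inc (pp Y) \o v \o l) z.
  apply: induced_ex; first exact: pp_surj.
  move=> y /approx_im[x <-].
  have := congr1 (ker_inc (pp Y)) (uv (pp X x)).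
  rewrite linearB -[X in ker_inc _ X - _]/(omega_map nA g (eta1 X (pp X x))).
  rewrite -[X in _ - ker_inc _ X]/(omega_map nA g' (eta1 X (pp X x))).
  rewrite gk gk' eta1E => e.
  by rewrite !sublE e /= lP subrr.
exists (gen0 Y); split; first exact: gen0P.
exists s, (pp Y) => z; have [y <-] := pp_surj z.
rewrite sP !sublE !linearB kP k'P.
by rewrite (ker_incP (v (l y))) subr0.
Qed.

Definition Sigma_Omega : adjunction Sigma (Omega nA) :=
  @Adjunction _ _ Sigma (Omega nA) eta1 eta1_nat eta1_univ_ex eta1_univ_uniq.
End Sigma.

(* The infimum in nat + {oo}, with None for oo. *)
Definition inf_nat (P : nat -> Prop) : option nat :=
  if pselect (exists n, `[< P n >]) is left h then Some (ex_minn h) else None.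

Definition conv_antiiso (L : pzRingType) : antiiso L^c L :=
  @Antiiso L^c L id id (fun x => erefl x) (fun x => erefl x)
    (fun x y => erefl (x + y)) (fun x y => erefl ((y : L) * (x : L)))
    (erefl (1 : L)).

Section Delooping.
Variables (L : pzRingType) (hN : noetherian L).

Definition stmodr : category := stmod L^c.

Definition OmegaPow (n : nat) : functor stmodr stmodr :=
  fpow (Omega (proj2 hN)) n.

Definition SigmaPow (n : nat) : functor stmodr stmodr :=
  fpowr (Sigma (conv_antiiso L) (proj1 hN)) n.

Definition SigmaPow_OmegaPow (n : nat) : adjunction (SigmaPow n) (OmegaPow n) :=
  adj_pow (Sigma_Omega (conv_antiiso L) (proj2 hN) (proj1 hN)) n.

Definition eta (n : nat) (X : stmodr) : hom X (OmegaPow n (SigmaPow n X)) :=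
  adj_unit (SigmaPow_OmegaPow n) X.

Definition dell (M : stmodr) : option nat :=
  inf_nat (fun n => exists N : stmodr, retract (OmegaPow n M) (OmegaPow n.+1 N)).
End Delooping.

(* Main.v *)
Require Import Defs.
From mathcomp Require Import all_boot all_order ssralg.
From mathcomp Require Import boolp.

Set Implicit Arguments.
Unset Strict Implicit.
Unset Printing Implicit Defensive.

(** For any adjunction F -| G, a section s : X -> G N factors through the unit
    as s = G(g) eta for some g : F X -> N, so a retraction r of s gives the
    retraction r G(g) of eta. Applied to Sigma^{n+1} -| Omega^{n+1} at
    X = Omega^n M, this is the step from (i) to (iii); the other implications
    hold by taking N = Sigma^{n+1} Omega^n M. *)

Lemma adj_unit_split (C D : category) (F : functor C D) (G : functor D C)
    (a : adjunction F G) (X : C) (N : D) :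
  retract X (G N) -> split_mono (adj_unit a X).
Proof.
move=> [s [r rs]]; have [g gs] := adj_unit_ex a s; exists (r \oo fmap G g).
apply: heq_trans (heq_sym (compmA _ _ _)) _.
exact: heq_trans (comp_heq (heq_refl _) gs) rs.
Qed.

Lemma split_mono_retract (C : category) (X Y : C) (s : hom X Y) :
  split_mono s -> retract X Y.
Proof. by exists s. Qed.

(** Equivalent predicates are equal by extensionality, so no minima need comparing. *)
Lemma eq_inf_nat (P Q : nat -> Prop) :
  (forall n, P n <-> Q n) -> inf_nat P = inf_nat Q.
Proof. by move=> PQ; congr inf_nat; apply: funext => n; apply: propext. Qed.

Theorem theorem1p10 (L : pzRingType) (hN : noetherian L) (hS : semiperfect L)
    (M : stmodr L) :
  (forall n : nat,
     ((exists N : stmodr L, retract (OmegaPow hN n M) (OmegaPow hN n.+1 N)) <->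
      retract (OmegaPow hN n M)
        (OmegaPow hN n.+1 (SigmaPow hN n.+1 (OmegaPow hN n M)))) /\
     (retract (OmegaPow hN n M)
        (OmegaPow hN n.+1 (SigmaPow hN n.+1 (OmegaPow hN n M))) <->
      split_mono (eta hN n.+1 (OmegaPow hN n M)))) /\
  dell hN M = inf_nat (fun n => split_mono (eta hN n.+1 (OmegaPow hN n M))).
Proof.
(* [eta] unfolds to the unit of [SigmaPow_OmegaPow], so the general fact applies; [N] stays
   arbitrary to serve both (i) and (ii). *)
have split_eta n N : retract (OmegaPow hN n M) (OmegaPow hN n.+1 N) ->
    split_mono (eta hN n.+1 (OmegaPow hN n M)) by exact: adj_unit_split.
split=> [n|]; last first.
  apply: eq_inf_nat => n; split=> [[N]|/split_mono_retract eta_retr].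
    exact: split_eta.
  (* Unification reads the witness [SigmaPow hN n.+1 (OmegaPow hN n M)] off the target of [eta]. *)
  by eexists; exact: eta_retr.
split; split.
(* (i) reaches (ii) by way of (iii). *)
- by case=> N /split_eta/split_mono_retract.
- by move=> retr; eexists; exact: retr.
- exact: split_eta.
- exact: split_mono_retract.
Qed.
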